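(* Let $(X,\mathcal F,\mu)$ be a $\sigma$-finite measure space, let $\mathbb P_0,\mathbb P_1$ be probability measures on $(X,\mathcal F)$ that are absolutely continuous with respect to $\mu$, with densities $p_0=d\mathbb P_0/d\mu$ and $p_1=d\mathbb P_1/d\mu$, and let $c_0>0$ and $c_1>0$ be real numbers. For $\mathcal C\in\mathcal F$ put $$J(\mathcal C)=c_0\,\mathbb P_0(\mathcal C)+c_1\,\mathbb P_1(\mathcal C^c)=\int_{\mathcal C}\left[c_0p_0(x)-c_1p_1(x)\right]d\mu+c_1 .$$ Then the minimum of $J(\mathcal C)$ over all measurable sets $\mathcal C\in\mathcal F$ is attained at $$\mathcal C^*=\{x\in X : c_0p_0(x)\le c_1p_1(x)\},$$ that is, $J(\mathcal C^* )\le J(\mathcal C)$ for every $\mathcal C\in\mathcal F$.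
   Context: Here $\mathcal C^c=X\setminus\mathcal C$ denotes the complement. The densities $p_0,p_1$ are (fixed versions of) the Radon-Nikodym derivatives, taken as measurable functions $X\to[0,\infty)$, so that $\mathbb P_i(A)=\int_A p_i\,d\mu$ for all $A\in\mathcal F$, $i=0,1$. Interpretation: when testing the simple hypothesis $H_0=\{\mathbb P_0\}$ against $H_1=\{\mathbb P_1\}$, $\mathcal C$ is the critical region (the set of observations for which $H_0$ is rejected), $c_0$ is the cost of rejecting $H_0$ when it is true, $c_1$ is the cost of rejecting $H_1$ when it is true, and $J(\mathcal C)$ is the total cost, weighting the type I error probability $\mathbb P_0(\mathcal C)$ by $c_0$ and the type II error probability $\mathbb P_1(\mathcal C^c)$ by $c_1$. *)

(* Defs.v *)
From HB Require Import structures.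
From mathcomp Require Import all_boot all_order all_algebra.
From mathcomp Require Import all_classical all_reals all_analysis.

Set Implicit Arguments.
Unset Strict Implicit.
Unset Printing Implicit Defensive.

Import Order.TTheory GRing.Theory Num.Theory.
Import numFieldNormedType.Exports.

Local Open Scope classical_set_scope.
Local Open Scope ring_scope.

(* p is an arbitrary fixed version, with values in [0, +oo[, of the
   Radon-Nikodym derivative of P with respect to mu. The library's
   Radon_Nikodym is one chosen \bar R-valued version, whose values are not
   guaranteed to be nonnegative at every point. *)
Definition is_density (d : measure_display) (X : measurableType d)
    (R : realType) (mu : {measure set X -> \bar R}) (P : probability X R)
    (p : X -> R) : Prop :=
  [/\ measurable_fun [set: X] p,
      forall x, 0 <= p x &
      forall A : set X, measurable A -> P A = (\int[mu]_(x in A) (p x)%:E)%E].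

Definition total_cost (d : measure_display) (X : measurableType d)
    (R : realType) (P0 P1 : probability X R) (c0 c1 : R) (C : set X) : \bar R :=
  (c0%:E * P0 C + c1%:E * P1 (~` C))%E.

Definition optimal_region (d : measure_display) (X : measurableType d)
    (R : realType) (p0 p1 : X -> R) (c0 c1 : R) : set X :=
  [set x | c0 * p0 x <= c1 * p1 x].

(* Main.v *)
Require Import Defs.
From HB Require Import structures.
From mathcomp Require Import all_boot all_order all_algebra.
From mathcomp Require Import all_classical all_reals all_analysis.
From mathcomp Require Import measurable_realfun.

(** For a measurable set C, finiteness of the two probabilities turns
    [P1 (~` C)] into [1 - P1 C], so the total cost is, up to the constant [c1],
    the integral over C of the signed density [f = c0 * p0 - c1 * p1]
    ([total_costE]). The problem thus becomes to choose the domain C on which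
    the integral of f is least. Adding to C points where [f > 0] can only
    raise the integral and adding points where [f <= 0] can only decrease
    it, so a best choice is the set [{f <= 0}], which is the claimed
    region ([integral_sign_set_min]). *)

Set Implicit Arguments.
Unset Strict Implicit.
Unset Printing Implicit Defensive.

Import Order.TTheory GRing.Theory Num.Theory.
Import numFieldNormedType.Exports.

Local Open Scope classical_set_scope.
Local Open Scope ring_scope.

Lemma integral_le0 (d : measure_display) (T : measurableType d)
    (R : realType) (mu : {measure set T -> \bar R}) (D : set T)
    (f : T -> \bar R) :
  (forall x, D x -> (f x <= 0)%E) -> (\int[mu]_(x in D) f x <= 0)%E.
Proof.
move=> f0; under eq_integral do rewrite -[f _]oppeK.
have Nf0 x : D x -> (0 <= - f x)%E by move=> Dx; rewrite oppe_ge0 f0.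
by rewrite integral_ge0N// oppe_le0 integral_ge0.
Qed.

(** Both integrals contain the integral over [A `&` S]. What A has besides,
    over [A `\` S], is nonnegative; what S has besides, over [S `\` A], is
    nonpositive. Each of the two comparisons only adds a term of known sign, so
    it is valid in the extended reals even when the integrals are infinite. *)
Lemma integral_sign_set_min (d : measure_display) (T : measurableType d)
    (R : realType) (mu : {measure set T -> \bar R}) (S A : set T)
    (f : T -> \bar R) :
  measurable S -> measurable A -> measurable_fun [set: T] f ->
  (forall x, S x -> (f x <= 0)%E) -> (forall x, ~ S x -> (0 <= f x)%E) ->
  (\int[mu]_(x in S) f x <= \int[mu]_(x in A) f x)%E.
Proof.
move=> mS mA mf fS fNS.
have splitE B E : measurable B -> measurable E ->
    (\int[mu]_(x in B) f x =
     \int[mu]_(x in B `&` E) f x + \int[mu]_(x in B `\` E) f x)%E.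
  move=> mB mE; rewrite -integral_setU ?setUIDK//.
  - exact: measurableI.
  - exact: measurableD.
  - exact: measurable_funS mf.
  - by apply/disj_set2P; rewrite setDE setIACA setICr setI0.
apply: (@le_trans _ _ (\int[mu]_(x in A `&` S) f x)%E).
  rewrite (splitE S A)// setIC geeDl//.
  by apply: integral_le0 => x [/fS].
rewrite (splitE A S)// leeDl//.
by apply: integral_ge0 => x [_ /fNS].
Qed.

(** The total mass [P [set: X] = 1] is finite and p is nonnegative, so p is
    integrable on the whole space, hence on every measurable set. *)
Lemma is_density_integrable (d : measure_display) (X : measurableType d)
    (R : realType) (mu : {measure set X -> \bar R}) (P : probability X R)
    (p : X -> R) (A : set X) :
  is_density mu P p -> measurable A -> mu.-integrable A (EFin \o p).
Proof.
move=> [mp p0 Pp] mA; apply: (@integrableS _ _ _ _ [set: X]) => //.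
apply/integrableP; split; first exact: measurableT_comp.
under eq_integral do rewrite /= ger0_norm//.
by rewrite -Pp// probability_setT ltry.
Qed.

Lemma total_costE (d : measure_display) (X : measurableType d)
    (R : realType) (mu : {measure set X -> \bar R}) (P0 P1 : probability X R)
    (p0 p1 : X -> R) (c0 c1 : R) (C : set X) :
  is_density mu P0 p0 -> is_density mu P1 p1 -> measurable C ->
  total_cost P0 P1 c0 c1 C =
  (\int[mu]_(x in C) (c0 * p0 x - c1 * p1 x)%:E + c1%:E)%E.
Proof.
move=> dp0 dp1 mC.
have ip0 := is_density_integrable dp0 mC.
have ip1 := is_density_integrable dp1 mC.
have [[_ _ P0E] [_ _ P1E]] := (dp0, dp1).
under eq_integral do rewrite EFinB !EFinM.
rewrite integralB//; [|exact: integrableZl|exact: integrableZl].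
rewrite !integralZl// -P0E// -P1E// /total_cost probability_setC//.
rewrite muleBr ?mule1 ?fin_num_adde_defr//.
by rewrite [(c1%:E - _)%E]addeC addeA.
Qed.

Theorem proposition4 (R : realType) (d : measure_display)
  (X : measurableType d) (mu : {sigma_finite_measure set X -> \bar R})
  (P0 P1 : probability X R) (p0 p1 : X -> R) (c0 c1 : R)
  (P0_mu : P0 `<< mu) (P1_mu : P1 `<< mu)
  (p0_density : is_density mu P0 p0) (p1_density : is_density mu P1 p1)
  (c0_gt0 : 0 < c0) (c1_gt0 : 0 < c1) :
  [/\ forall C : set X, measurable C ->
        total_cost P0 P1 c0 c1 C =
        (\int[mu]_(x in C) (c0 * p0 x - c1 * p1 x)%:E + c1%:E)%E,
      measurable (optimal_region p0 p1 c0 c1) &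
      forall C : set X, measurable C ->
        (total_cost P0 P1 c0 c1 (optimal_region p0 p1 c0 c1) <=
         total_cost P0 P1 c0 c1 C)%E].
Proof.
have [mp0 _ _] := p0_density; have [mp1 _ _] := p1_density.
have mopt : measurable (optimal_region p0 p1 c0 c1).
  rewrite -[optimal_region _ _ _ _]setTI.
  by apply: measurable_fun_le => //; exact: measurable_funM.
split=> // [C mC|C mC]; first exact: total_costE.
rewrite !(total_costE _ _ p0_density p1_density)// leeD2r//.
apply: integral_sign_set_min => //.
- apply/measurable_EFinP; apply: measurable_funB; exact: measurable_funM.
- by move=> x; rewrite lee_fin subr_le0.
- by move=> x /negP; rewrite -ltNge lee_fin subr_ge0 => /ltW.
Qed.
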